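(* Let $K$ be a field. For $n\ge 1$ let $\Gamma_n$ be the following graph, which is the graph of relations of the full binary tree truncated operad (the quotient of the free binary operad by all tree-monomials with three binary operations, restricted to the full binary tree with $n+2$ levels of operations): the vertices are the non-root internal vertices of that tree, i.e. $2^{j+1}$ vertices at level $j$ for $j=0,1,\dots,n$; two vertices are joined by an edge if one is the parent of the other in the tree or if they are siblings (the two vertices of level $0$ are siblings). Let $H^{(n)}=H^\bullet(A_{\Gamma_n})$. Define sequences by $$a_1=p_1=q_1=0,\qquad b_1=c_1=r_1=1,$$ $$a_{n+1}=c_n^2,\quad b_{n+1}=(a_n+2q_n)^2,\quad c_{n+1}=(a_n+2p_n+2r_n)^2,$$ $$p_{n+1}=c_n(a_n+2q_n),\quad q_{n+1}=c_n(a_n+2p_n+2r_n),\quad r_{n+1}=(a_n+2q_n)(a_n+2p_n+2r_n).$$ Then for all $n\ge 1$, $$\dim_K H^{(n)}=a_n+c_n+2p_n+2r_n.$$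
   Context: For a finite simple graph $G$ with vertices $x_1,\dots,x_N$, $A_G$ is the quotient of the Grassmann (exterior) algebra over $K$ on $x_1,\dots,x_N$ by the ideal generated by the monomials $x_ix_j$ for all edges $\{x_i,x_j\}$ of $G$, regarded as a complex with differential $D(\xi)=(x_1+\cdots+x_N)\xi$; $H^\bullet(A_G)=\ker D/\operatorname{im}D$ is its total homology. *)

(* Defs.v *)
From HB Require Import structures.
From mathcomp Require Import all_boot all_algebra all_field.
From mathcomp Require Import generic_quotient ring_quotient.

Set Implicit Arguments.
Unset Strict Implicit.
Unset Printing Implicit Defensive.

Import GRing.Theory.
Local Open Scope ring_scope.
Local Open Scope quotient_scope.

(* Quotient of a finite-dimensional vector space by a subspace. The library's
   Quotient.quot is only a zmodType: the scalar action and the finite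
   dimension are added here. *)
Section QuotientSpace.
Variables (K : fieldType) (vT : vectType K) (U : {vspace vT}).

Definition quotv : Type :=
  Quotient.quot (GRing.ZmodClosed.clone _ (pred_of_vspace U) _).

HB.instance Definition _ := GRing.Zmodule.on quotv.
HB.instance Definition _ := EqQuotient.on quotv.

Definition piv (v : vT) : quotv := \pi v.

Lemma pivE u v : (piv u == piv v) = (u - v \in U).
Proof. by rewrite Quotient.idealrBE. Qed.

Lemma piv_repr (x : quotv) : piv (repr x) = x.
Proof. exact: reprK. Qed.

Lemma repr_piv v : repr (piv v) - v \in U.
Proof. by rewrite -pivE piv_repr. Qed.

Lemma pivD u v : piv (u + v) = piv u + piv v.
Proof. by rewrite /piv !piE. Qed.

Definition quotv_scale (k : K) (x : quotv) : quotv := piv (k *: repr x).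

Lemma quotv_scaleE k v : quotv_scale k (piv v) = piv (k *: v).
Proof. by apply/eqP; rewrite pivE -scalerBr memvZ // repr_piv. Qed.

Fact quotv_scaleA a b x :
  quotv_scale a (quotv_scale b x) = quotv_scale (a * b) x.
Proof. by rewrite -[x]piv_repr !quotv_scaleE scalerA. Qed.

Fact quotv_scale1 : left_id 1 quotv_scale.
Proof. by move=> x; rewrite -[x]piv_repr quotv_scaleE scale1r. Qed.

Fact quotv_scaleDr : right_distributive quotv_scale +%R.
Proof.
move=> k x y; rewrite -[x]piv_repr -[y]piv_repr.
by rewrite -pivD !quotv_scaleE scalerDr pivD.
Qed.

Fact quotv_scaleDl x : {morph quotv_scale^~ x : a b / a + b}.
Proof.
by move=> a b; rewrite -[x]piv_repr !quotv_scaleE scalerDl pivD.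
Qed.

HB.instance Definition _ := GRing.Zmodule_isLmodule.Build K quotv
  quotv_scaleA quotv_scale1 quotv_scaleDr quotv_scaleDl.

Lemma pivZ k v : piv (k *: v) = k *: piv v.
Proof. exact/esym/quotv_scaleE. Qed.

Fact piv_is_linear : linear piv.
Proof. by move=> k u v; rewrite pivD pivZ. Qed.
HB.instance Definition _ := GRing.isSemilinear.Build K vT quotv _ piv
  (GRing.semilinear_linear piv_is_linear).

Let W : {vspace vT} := (U^C)%VS.

Let capWU : (W :&: U = 0)%VS.
Proof. by rewrite capvC capv_compl. Qed.

Let pr (x : quotv) : vT := daddv_pi W U (repr x).

Let pr_piv v : pr (piv v) = daddv_pi W U v.
Proof.
have Uu: repr (piv v) - v \in U := repr_piv v.
apply/eqP; rewrite -subr_eq0 -linearB /=.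
have := @daddv_pi_add _ _ W U (repr (piv v) - v) capWU.
rewrite addvC addv_complf memvf => /(_ isT).
rewrite [daddv_pi U W _]daddv_pi_id ?capv_compl // => /eqP.
by rewrite -subr_eq0 addrK.
Qed.

Let piv_pr x : piv (pr x) = x.
Proof.
apply/eqP; rewrite -[X in _ == X]piv_repr pivE /pr.
have := @daddv_pi_add _ _ W U (repr x) capWU.
rewrite addvC addv_complf memvf => /(_ isT) {2}<-.
by rewrite opprD addNKr memvN memv_pi.
Qed.

Fact quotv_vect_iso : Vector.axiom (\dim W) quotv.
Proof.
exists (fun x => \row_i coord (vbasis W) i (pr x)).
  move=> k x y; rewrite -[x]piv_repr -[y]piv_repr -pivZ -pivD.
  by apply/rowP=> i; rewrite !mxE !pr_piv !linearP.
exists (fun rw : 'rV_(\dim W) => piv (\sum_i rw 0 i *: (vbasis W)`_i)).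
  move=> x /=; have Wx: pr x \in W by exact: memv_pi.
  rewrite -[RHS]piv_pr [in RHS](coord_vbasis Wx).
  by congr piv; apply: eq_bigr => i _; rewrite mxE.
move=> rw; apply/rowP=> i; rewrite mxE pr_piv daddv_pi_id //.
  by rewrite coord_sum_free ?(basis_free (vbasisP W)).
by apply: rpred_sum => j _; rewrite rpredZ ?vbasis_mem ?memt_nth.
Qed.
HB.instance Definition _ := Lmodule_hasFinDim.Build K quotv quotv_vect_iso.

End QuotientSpace.

(* ker D / im D for an endomorphism D; im D is viewed inside ker D (it is
   contained in it when D \o D = 0). *)
Definition homology (K : fieldType) (vT : vectType K) (D : 'End(vT)) :=
  quotv (linfun (vsval : subvs_of (lker D) -> vT) @^-1: limg D)%VS.
HB.instance Definition _ K vT D := Vector.on (@homology K vT D).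

Definition homology_dim (K : fieldType) (vT : vectType K) (D : 'End(vT)) : nat :=
  \dim {: homology D}.

(* Quotient of a finite-dimensional algebra by the two-sided ideal generated
   by a sequence X. It is a pzRingType and a vectType but not an
   lalgType, since the latter excludes the zero ring (the ideal may contain 1). *)
Section QuotientAlgebra.
Variables (K : fieldType) (E : falgType K) (X : seq E).

Definition ideal_gen : {vspace E} := ({:E} * <<X>> * {:E})%VS.

Lemma mem_ideal_gen x : x \in X -> x \in ideal_gen.
Proof.
by move=> Xx; rewrite -[x]mul1r -[_ * _]mulr1 !memv_mul ?memvf ?memv_span.
Qed.

Lemma ideal_genMl a x : x \in ideal_gen -> a * x \in ideal_gen.
Proof.
move=> Ix; have: a * x \in ({:E} * ideal_gen)%VS by rewrite memv_mul ?memvf.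
by rewrite /ideal_gen !prodvA; apply: subvP; rewrite !prodvSl ?subvf.
Qed.

Lemma ideal_genMr a x : x \in ideal_gen -> x * a \in ideal_gen.
Proof.
move=> Ix; have: x * a \in (ideal_gen * {:E})%VS by rewrite memv_mul ?memvf.
by rewrite /ideal_gen -!prodvA; apply: subvP; rewrite !prodvSr ?subvf.
Qed.

Definition quot_alg : Type := quotv ideal_gen.
HB.instance Definition _ := Vector.on quot_alg.

Definition pi_alg (a : E) : quot_alg := piv ideal_gen a.
Fact pi_alg_is_linear : linear pi_alg.
Proof. exact: piv_is_linear. Qed.
HB.instance Definition _ := GRing.isSemilinear.Build K E quot_alg _ pi_alg
  (GRing.semilinear_linear pi_alg_is_linear).

Definition quot_alg_mul (x y : quot_alg) : quot_alg :=
  pi_alg (repr (x : quotv _) * repr (y : quotv _)).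

Lemma pi_algE a b : (pi_alg a == pi_alg b) = (a - b \in ideal_gen).
Proof. exact: pivE. Qed.

Lemma pi_algP (x : quot_alg) : {a | x = pi_alg a}.
Proof. by exists (repr (x : quotv _)); rewrite [RHS]piv_repr. Qed.

Lemma quot_alg_mulE a b : quot_alg_mul (pi_alg a) (pi_alg b) = pi_alg (a * b).
Proof.
apply/eqP; rewrite pi_algE; set a' := repr _; set b' := repr _.
have ->: a' * b' - a * b = (a' - a) * b' + a * (b' - b).
  by rewrite mulrBl mulrBr addrA subrK.
by apply: rpredD; [apply: ideal_genMr | apply: ideal_genMl]; apply: repr_piv.
Qed.

Fact quot_alg_mulA : associative quot_alg_mul.
Proof.
move=> x y z; have [[[a ->] [b ->]] [c ->]] := (pi_algP x, pi_algP y, pi_algP z).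
by rewrite !quot_alg_mulE mulrA.
Qed.

Fact quot_alg_mul1 : left_id (pi_alg 1) quot_alg_mul.
Proof. by move=> x; have [a ->] := pi_algP x; rewrite quot_alg_mulE mul1r. Qed.

Fact quot_alg_mulr1 : right_id (pi_alg 1) quot_alg_mul.
Proof. by move=> x; have [a ->] := pi_algP x; rewrite quot_alg_mulE mulr1. Qed.

Fact quot_alg_mulDl : left_distributive quot_alg_mul +%R.
Proof.
move=> x y z; have [[[a ->] [b ->]] [c ->]] := (pi_algP x, pi_algP y, pi_algP z).
by rewrite -linearD !quot_alg_mulE mulrDl linearD.
Qed.

Fact quot_alg_mulDr : right_distributive quot_alg_mul +%R.
Proof.
move=> x y z; have [[[a ->] [b ->]] [c ->]] := (pi_algP x, pi_algP y, pi_algP z).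
by rewrite -linearD !quot_alg_mulE mulrDr linearD.
Qed.

HB.instance Definition _ := GRing.Zmodule_isPzRing.Build quot_alg
  quot_alg_mulA quot_alg_mul1 quot_alg_mulr1 quot_alg_mulDl quot_alg_mulDr.

Let pi_algM a b : pi_alg (a * b) = pi_alg a * pi_alg b.
Proof. exact/esym/quot_alg_mulE. Qed.

Lemma quot_alg_scalerAl (k : K) (x y : quot_alg) : k *: (x * y) = k *: x * y.
Proof.
have [[a ->] [b ->]] := (pi_algP x, pi_algP y).
by rewrite -pi_algM -!linearZ -pi_algM scalerAl.
Qed.

Lemma quot_alg_scalerAr (k : K) (x y : quot_alg) : k *: (x * y) = x * (k *: y).
Proof.
have [[a ->] [b ->]] := (pi_algP x, pi_algP y).
by rewrite -pi_algM -!linearZ -pi_algM scalerAr.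
Qed.

Fact pi_alg_is_monoid_morphism : monoid_morphism pi_alg.
Proof. by split=> //; apply: pi_algM. Qed.
HB.instance Definition _ := GRing.isMonoidMorphism.Build E quot_alg pi_alg
  pi_alg_is_monoid_morphism.

End QuotientAlgebra.

(* The Grassmann algebra on the finite set of generators V: the basis
   monomials are indexed by the subsets S of V, the monomial of S being the
   product of its elements in increasing order. The order on V is the one given
   by its enumeration. *)
Definition grassmann (K : fieldType) (V : finType) := {ffun {set V} -> K^o}.

Section Grassmann.
Variables (K : fieldType) (V : finType).
Local Notation E := (grassmann K V).
Implicit Types (S T U : {set V}) (x y z : E).

HB.instance Definition _ := Vector.on E.

Definition gmon S : E := [ffun T => (T == S)%:R].

(* Number of adjacent transpositions needed to sort the concatenation of S and T. *)
Definition ninv S T : nat :=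
  #|[set p in setX S T | (enum_rank p.2 < enum_rank p.1)%N]|.

Definition gmon_mul S T : E :=
  if [disjoint S & T] then (-1) ^+ ninv S T *: gmon (S :|: T) else 0.

Definition gmul x y : E := \sum_S \sum_T (x S * y T) *: gmon_mul S T.

Lemma gmon_expand x : x = \sum_S x S *: gmon S.
Proof.
apply/ffunP=> T; rewrite sum_ffunE (bigD1 T) //= !ffunE eqxx big1 => [|S neqST].
  by rewrite addr0 [RHS]mulr1.
by rewrite !ffunE eq_sym (negPf neqST) [LHS]mulr0.
Qed.

Lemma gmon_ind (P : E -> Prop) :
    (forall x y, P x -> P y -> P (x + y)) -> (forall k x, P x -> P (k *: x)) ->
  (forall S, P (gmon S)) -> forall x, P x.
Proof.
move=> PD PZ Pmon x; rewrite [x]gmon_expand; apply: big_ind => //.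
  by rewrite -(scale0r (gmon set0)); apply: PZ.
by move=> S _; apply: PZ.
Qed.

Fact gmulDl : left_distributive gmul +%R.
Proof.
move=> x y z; rewrite -big_split; apply: eq_bigr => S _.
rewrite -big_split; apply: eq_bigr => T _.
by rewrite ffunE mulrDl scalerDl.
Qed.

Fact gmulDr : right_distributive gmul +%R.
Proof.
move=> x y z; rewrite -big_split; apply: eq_bigr => S _.
rewrite -big_split; apply: eq_bigr => T _.
by rewrite ffunE mulrDr scalerDl.
Qed.

Fact gmulZl k x y : k *: gmul x y = gmul (k *: x) y.
Proof.
rewrite scaler_sumr; apply: eq_bigr => S _.
rewrite scaler_sumr; apply: eq_bigr => T _.
by rewrite ffunE scalerA mulrA.
Qed.

Fact gmulZr k x y : k *: gmul x y = gmul x (k *: y).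
Proof.
rewrite scaler_sumr; apply: eq_bigr => S _.
rewrite scaler_sumr; apply: eq_bigr => T _.
by rewrite ffunE scalerA mulrCA.
Qed.

Let gmul0l y : gmul 0 y = 0.
Proof. by rewrite -(scale0r 0) -gmulZl !scale0r. Qed.

Let gmul0r x : gmul x 0 = 0.
Proof. by rewrite -(scale0r 0) -gmulZr !scale0r. Qed.

Lemma gmul_mon S T : gmul (gmon S) (gmon T) = gmon_mul S T.
Proof.
rewrite /gmul (bigD1 S) //= [X in _ + X]big1 => [|S' neqS]; last first.
  by rewrite big1 // => T' _; rewrite ffunE (negPf neqS) mul0r scale0r.
rewrite addr0 (bigD1 T) //= [X in _ + X]big1 => [|T' neqT]; last first.
  by rewrite !ffunE (negPf neqT) mulr0 scale0r.
by rewrite addr0 !ffunE !eqxx mulr1 scale1r.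
Qed.

Lemma ninvUl S T U :
  [disjoint S & T] -> ninv (S :|: T) U = (ninv S U + ninv T U)%N.
Proof.
move=> dST; rewrite /ninv -cardsUI [X in (_ + X)%N]eq_card0 ?addn0.
  by apply: eq_card => p; rewrite !inE -andb_orl -andb_orl.
move=> p; rewrite !inE; apply/negP.
case/andP=> /andP[/andP[Sp1 _] _] /andP[/andP[Tp1 _] _].
by rewrite (disjointFr dST Sp1) in Tp1.
Qed.

Lemma ninvUr S T U :
  [disjoint T & U] -> ninv S (T :|: U) = (ninv S T + ninv S U)%N.
Proof.
move=> dTU; rewrite /ninv -cardsUI [X in (_ + X)%N]eq_card0 ?addn0.
  by apply: eq_card => p; rewrite !inE -andb_orl -andb_orr.
move=> p; rewrite !inE; apply/negP.
case/andP=> /andP[/andP[_ Tp2] _] /andP[/andP[_ Up2] _].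
by rewrite (disjointFr dTU Tp2) in Up2.
Qed.

Let gmon_mulA S T U :
  gmul (gmon S) (gmon_mul T U) = gmul (gmon_mul S T) (gmon U).
Proof.
have dU: [disjoint S :|: T & U] = [disjoint S & U] && [disjoint T & U].
  by rewrite -!setI_eq0 setIUl setU_eq0.
have dS: [disjoint S & T :|: U] = [disjoint S & T] && [disjoint S & U].
  by rewrite -!setI_eq0 setIUr setU_eq0.
rewrite /gmon_mul; have [dTU|dTU] := ifP; have [dST|dST] := ifP; last by rewrite gmul0l gmul0r.
- rewrite -gmulZl -gmulZr !gmul_mon /gmon_mul dU dS dST dTU andbT /=.
  case: ifP => dSU; last by rewrite !scaler0.
  by rewrite !scalerA -!exprD ninvUl // ninvUr // setUA addnC -addnA.
- by rewrite -gmulZr gmul0l gmul_mon /gmon_mul dS dST scaler0.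
- by rewrite -gmulZl gmul0r gmul_mon /gmon_mul dU dTU andbF scaler0.
Qed.

Fact gmulA : associative gmul.
Proof.
move=> x y z; elim/gmon_ind: x => [x x' IH IH'|k x IH|S].
- by rewrite !gmulDl IH IH'.
- by rewrite -!gmulZl IH.
elim/gmon_ind: y => [y y' IH IH'|k y IH|T].
- by rewrite gmulDl !gmulDr gmulDl IH IH'.
- by rewrite -gmulZr -!gmulZl -gmulZr IH.
elim/gmon_ind: z => [z z' IH IH'|k z IH|U].
- by rewrite !gmulDr IH IH'.
- by rewrite -!gmulZr IH.
by rewrite !gmul_mon gmon_mulA.
Qed.

Fact gmul1l : left_id (gmon set0) gmul.
Proof.
elim/gmon_ind=> [x x' IH IH'|k x IH|S]; rewrite ?gmulDr -?gmulZr ?IH ?IH' //.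
rewrite gmul_mon /gmon_mul -setI_eq0 set0I eqxx set0U.
rewrite /ninv (eq_card0 (A := [set _ | _])) ?scale1r // => p.
by rewrite !inE.
Qed.

Fact gmul1r : right_id (gmon set0) gmul.
Proof.
elim/gmon_ind=> [x x' IH IH'|k x IH|S]; rewrite ?gmulDl -?gmulZl ?IH ?IH' //.
rewrite gmul_mon /gmon_mul -setI_eq0 setI0 eqxx setU0.
rewrite /ninv (eq_card0 (A := [set _ | _])) ?scale1r // => p.
by rewrite !inE andbF.
Qed.

Fact gmon0_neq0 : gmon set0 != 0.
Proof.
by apply/eqP=> /ffunP/(_ set0)/eqP; rewrite !ffunE eqxx oner_eq0.
Qed.

HB.instance Definition _ := GRing.Zmodule_isNzRing.Build E
  gmulA gmul1l gmul1r gmulDl gmulDr gmon0_neq0.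
HB.instance Definition _ := GRing.Lmodule_isLalgebra.Build K E gmulZl.
HB.instance Definition _ := GRing.Lalgebra_isAlgebra.Build K E gmulZr.
HB.instance Definition _ := Algebra_isFalgebra.Build K E.

Definition gvar (v : V) : E := gmon [set v].

Lemma gvar_sqr v : gvar v * gvar v = 0.
Proof.
rewrite [LHS]gmul_mon /gmon_mul -setI_eq0 setIid.
by rewrite -cards_eq0 cards1.
Qed.

Let ninv1 u v : ninv [set u] [set v] = (enum_rank v < enum_rank u)%N.
Proof.
rewrite /ninv; have [lt_vu|le_uv] := ltnP (enum_rank v) (enum_rank u).
  apply/eqP/cards1P; exists (u, v); apply/setP=> -[s t]; rewrite !inE /=.
  rewrite xpair_eqE; apply: andb_idr => /andP[/eqP-> /eqP->]; exact: lt_vu.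
apply: eq_card0 => -[s t]; rewrite !inE /=.
by apply/negP=> /andP[/andP[/eqP-> /eqP->]]; rewrite ltnNge le_uv.
Qed.

Lemma gvar_anticomm u v : gvar u * gvar v = - (gvar v * gvar u).
Proof.
have [<-|neq_uv] := eqVneq u v; first by rewrite gvar_sqr oppr0.
rewrite [gvar u * _]gmul_mon [gvar v * _]gmul_mon /gmon_mul.
rewrite !disjoints1 !inE neq_uv eq_sym neq_uv setUC !ninv1.
have: enum_rank u != enum_rank v :> nat.
  by apply: contraNneq neq_uv => /val_inj/enum_rank_inj->.
by case: ltngtP => // _ _; rewrite ?expr0 ?expr1 !scaleN1r ?scale1r ?opprK.
Qed.

Lemma gvar_sum_sqr : (\sum_v gvar v) * (\sum_v gvar v) = 0.
Proof.
have swap_inj: injective (fun p : V * V => (p.2, p.1)).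
  by move=> [a b] [c d] [-> ->].
rewrite mulr_suml; under eq_bigr do rewrite mulr_sumr.
rewrite pair_big /= (bigID [pred p : V * V | (enum_rank p.1 < enum_rank p.2)%N]).
rewrite /= [X in _ + X](bigID [pred p : V * V | p.1 == p.2]) /=.
rewrite [X in _ + (X + _)]big1 => [|p /andP[_ /eqP->]]; last exact: gvar_sqr.
rewrite add0r [X in _ + X](reindex_inj swap_inj) /=.
rewrite [X in _ + X](eq_bigl [pred p | (enum_rank p.1 < enum_rank p.2)%N]).
  by rewrite -big_split big1 //= => p _; rewrite gvar_anticomm addNr.
move=> p /=; rewrite -leqNgt leq_eqVlt andb_orl.
rewrite -(inj_eq enum_rank_inj) -val_eqE /= eq_sym.
by case: ltngtP.
Qed.

End Grassmann.

Record sgraph (V : finType) := SGraph {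
  adj :> rel V;
  adj_sym : symmetric adj;
  adj_irr : irreflexive adj
}.

Section GraphAlgebra.
Variables (K : fieldType) (V : finType) (G : sgraph V).

Definition edge_monomials : seq (grassmann K V) :=
  [seq gvar K e.1 * gvar K e.2 | e <- enum [pred e : V * V | G e.1 e.2]].

Definition graph_alg : Type := quot_alg edge_monomials.
HB.instance Definition _ := GRing.PzRing.on graph_alg.
HB.instance Definition _ := Vector.on graph_alg.

Definition avar (v : V) : graph_alg := pi_alg edge_monomials (gvar K v).

Definition dmul (xi : graph_alg) : graph_alg := (\sum_(v : V) avar v) * xi.

Fact dmul_is_linear : linear dmul.
Proof.
move=> k x y; rewrite /dmul mulrDr.
by congr (_ + _); apply/esym; apply: (@quot_alg_scalerAr K _ edge_monomials).
Qed.
HB.instance Definition _ := GRing.isSemilinear.Build K graph_alg graph_alg _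
  dmul (GRing.semilinear_linear dmul_is_linear).

Definition graph_diff : 'End(graph_alg) := linfun dmul.

Lemma graph_diffE xi : graph_diff xi = (\sum_(v : V) avar v) * xi.
Proof. exact: lfunE. Qed.

Lemma avar_edge u v : G u v -> avar u * avar v = 0.
Proof.
move=> Guv; have: gvar K u * gvar K v \in edge_monomials.
  by apply/mapP; exists (u, v); rewrite ?mem_enum.
move=> /mem_ideal_gen Iuv; rewrite /avar -[LHS]rmorphM -(rmorph0 (pi_alg _)).
by apply/eqP; rewrite pi_algE subr0.
Qed.

Lemma graph_diff_sqr xi : graph_diff (graph_diff xi) = 0.
Proof.
rewrite !graph_diffE mulrA; set s := \sum_v _.
have ->: s = pi_alg edge_monomials (\sum_v gvar K v) by rewrite raddf_sum.
rewrite -[X in X * _]rmorphM.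
by rewrite gvar_sum_sqr rmorph0 mul0r.
Qed.

Lemma graph_diff_img_ker : (limg graph_diff <= lker graph_diff)%VS.
Proof.
apply/subvP=> _ /memv_imgP[x _ ->].
by rewrite memv_ker graph_diff_sqr.
Qed.

End GraphAlgebra.

(* The non-root internal vertices of the full binary tree at levels 0, ..., n:
   a vertex of level j is the word of length j + 1 of the left/right choices
   on the path from the root to it. *)
Definition tree_vertex (n : nat) : finType := {j : 'I_n.+1 & j.+1.-tuple bool}.

Section TreeGraph.
Variable n : nat.
Implicit Types u v : tree_vertex n.

Definition word u : seq bool := val (tagged u).

(* The word of the parent; it is [::], the root, for u of level 0. *)
Definition parent u : seq bool := take (tag u) (word u).

Definition is_parent u v : bool := word u == parent v.

Definition siblings u v : bool := (u != v) && (parent u == parent v).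

Definition Gamma_adj u v : bool :=
  [|| is_parent u v, is_parent v u | siblings u v].

Fact Gamma_adj_sym : symmetric Gamma_adj.
Proof.
by move=> u v; rewrite /Gamma_adj /siblings orbCA eq_sym [parent u == _]eq_sym.
Qed.

Fact Gamma_adj_irr : irreflexive Gamma_adj.
Proof.
move=> u; rewrite /Gamma_adj /siblings eqxx orbF orbb; apply/eqP.
move/(congr1 size); rewrite size_take size_tuple ltnSn => /eqP.
by rewrite (gtn_eqF (ltnSn _)).
Qed.

Definition Gamma : sgraph (tree_vertex n) := SGraph Gamma_adj_sym Gamma_adj_irr.

Lemma card_level (j : 'I_n.+1) :
  #|[set u : tree_vertex n | tag u == j]| = (2 ^ j.+1)%N.
Proof.
pose f (t : j.+1.-tuple bool) : tree_vertex n :=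
  Tagged (fun j : 'I_n.+1 => j.+1.-tuple bool) t.
have f_inj: injective f by move=> t t' /eqP; rewrite eq_Tagged => /eqP.
rewrite -(card_bool) -card_tuple -(card_imset predT f_inj).
apply: eq_card => -[i t]; rewrite !inE /=; apply/eqP/imsetP => [ij|[t' _ /(congr1 tag)]//].
by subst i; exists t.
Qed.

End TreeGraph.

(* Main.v *)
(* A_G is the cochain complex of the independence complex of G. Write h(S) for
   the total homology dimension of the subgraph induced on S. If v, w are
   adjacent in S and the neighbours of v in S are w or neighbours of w, then the
   long exact sequence of the pair (S, S - w) splits:
   h(S) = h(S - w) + h(S - N[w]); and h(S) = 0 if S has an isolated vertex.
   Gluing a subtree T at its root x to a graph S only involves the restriction
   map H(T - x) -> H(T - N[x]); let rho, kap, sig be its rank and the dimensions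
   of its kernel and cokernel. Then
     h(S u T) = rho h(S) + kap h(S - x) + sig h(S - N[x]),
   and the recursion above computes (rho, kap, sig) for a tree from those of its
   two branches. The sequences of the theorem are
     a = rho^2, b = sig^2, c = kap^2, p = rho sig, q = rho kap, r = kap sig. *)

From HB Require Import structures.
Require Import Defs.
From mathcomp Require Import all_boot all_algebra all_field zify ring.

Set Implicit Arguments.
Unset Strict Implicit.
Unset Printing Implicit Defensive.

Import GRing.Theory.

(** * Dimension counts for preimages, quotients and homology *)

Section LinearAlgebra.
Local Open Scope ring_scope.
Variable K : fieldType.

(** [f] induces an isomorphism from [U] modulo [f @^-1: J] onto [f @: U + J] modulo [J]; comparing
    dimensions without subtraction gives the formula. *)
Lemma dim_limgD (aT rT : vectType K) (f : 'Hom(aT, rT)) (U : {vspace aT})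
    (J : {vspace rT}) :
  (f @^-1: J <= U)%VS ->
  (\dim (f @: U + J) + \dim (f @^-1: J) = \dim U + \dim J)%N.
Proof.
move=> sJU.
have sker (W : {vspace aT}) : (f @^-1: J <= W)%VS -> (W :&: lker f = lker f)%VS.
  move=> sJW; apply/capv_idPr/(subv_trans _ sJW)/subvP=> x.
  by rewrite memv_ker -memv_preim => /eqP->; rewrite mem0v.
have capE : (f @: U :&: J = f @: (f @^-1: J))%VS.
  apply/vspaceP=> y; rewrite memv_cap; apply/andP/memv_imgP.
    case=> /memv_imgP[x Ux ->] Jx; exists x => //.
    by rewrite -memv_preim.
  case=> x Jx ->; split; last by rewrite memv_preim.
  by apply/memv_img/(subvP sJU).
have := limg_ker_dim f U; have := limg_ker_dim f (f @^-1: J)%VS.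
rewrite !sker // -capE => <- <-.
by rewrite -addnA addnCA dimv_sum_cap addnCA addnA.
Qed.

Lemma dim_quotv (vT : vectType K) (U : {vspace vT}) :
  (\dim {: quotv U} + \dim U = \dim {:vT})%N.
Proof.
pose f : 'Hom(vT, quotv U) := linfun (piv U).
have := limg_ker_dim f fullv; rewrite capfv addnC => <-; congr (_ + _)%N.
  congr (\dim _); apply/vspaceP=> y; rewrite memvf; apply/esym/memv_imgP.
  by exists (repr y); rewrite ?memvf // lfunE /= piv_repr.
congr (\dim _); apply/vspaceP=> x; rewrite memv_ker lfunE /=.
by have := pivE U x 0; rewrite subr0 linear0.
Qed.

Lemma homology_dimE (vT : vectType K) (D : 'End(vT)) :
  (limg D <= lker D)%VS -> (homology_dim D + \dim (limg D) = \dim (lker D))%N.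
Proof.
move=> sDD; rewrite /homology_dim.
pose i : 'Hom(subvs_of (lker D), vT) := linfun vsval.
have iE x : i x = vsval x by rewrite lfunE.
have := dim_quotv (i @^-1: limg D)%VS; rewrite dimvf => /esym/= dimE.
have ker0 : (i @^-1: limg D :&: lker i = 0)%VS.
  apply/eqP; rewrite -subv0; apply/subvP=> x; rewrite memv_cap memv_ker iE.
  by case/andP=> _ /eqP x0; rewrite memv0; apply/eqP/val_inj; rewrite [LHS]x0.
have imgE : (i @: (i @^-1: limg D) = limg D)%VS.
  apply/vspaceP=> y; apply/memv_imgP/idP => [[x]|Dy].
    by rewrite -memv_preim => Dx ->.
  have Ky := subvP sDD _ Dy; exists (vsproj (lker D) y).
    by rewrite -memv_preim iE vsprojK.
  by rewrite iE vsprojK.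
have := limg_ker_dim i (i @^-1: limg D)%VS; rewrite ker0 dimv0 imgE add0n => ->.
rewrite -dimE. exact: (dimvf (subvs_of (lker D))).
Qed.

End LinearAlgebra.

(** * Coefficients of products with a generator *)

Section GrassmannCoefficients.
Local Open Scope ring_scope.
Variables (K : fieldType) (V : finType).
Local Notation E := (grassmann K V).
Implicit Types (x y : E) (u v : V) (S T : {set V}).

Lemma gmul_coef x y T :
  (x * y) T = \sum_A \sum_B x A * y B * gmon_mul K A B T.
Proof.
rewrite [LHS]sum_ffunE; apply: eq_bigr => A _; rewrite sum_ffunE.
by apply: eq_bigr => B _; rewrite ffunE.
Qed.

Lemma gmon_mul_coef0 A B T :
  (A :|: B != T) || ~~ [disjoint A & B] -> gmon_mul K A B T = 0.
Proof.
rewrite /gmon_mul; case: ifP => [dAB|_ _]; last by rewrite ffunE.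
by rewrite orbF !ffunE eq_sym => /negPf->; apply: mulr0.
Qed.

Lemma gvarM_coef u x T :
  (gvar K u * x) T =
    if u \in T then (-1) ^+ ninv [set u] (T :\ u) * x (T :\ u) else 0.
Proof.
rewrite gmul_coef (bigD1 [set u]) //= [X in _ + X]big1 ?addr0; last first.
  by move=> A neqA; rewrite big1 // => B _; rewrite !ffunE (negPf neqA) !mul0r.
under eq_bigr do rewrite ffunE eqxx mul1r.
case: ifP => [uT|uNT]; last first.
  apply: big1 => B _; rewrite gmon_mul_coef0 ?mulr0 //.
  by apply/orP; left; apply: contraFneq uNT => <-; rewrite !inE eqxx.
rewrite (bigD1 (T :\ u)) //= big1 ?addr0 => [|B neqB].
  rewrite /gmon_mul disjoints1 !inE eqxx /= setD1K // !ffunE eqxx mulrC.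
  by congr (_ * _); apply: mulr1.
rewrite gmon_mul_coef0 ?mulr0 // -implybE; apply/implyP => /eqP defT.
by apply: contraNN neqB; rewrite -defT disjoints1 => uNB; rewrite setU1K.
Qed.

Lemma gvar_sum_anticomm u :
  gvar K u * (\sum_v gvar K v) = - ((\sum_v gvar K v) * gvar K u).
Proof.
rewrite mulr_sumr mulr_suml -sumrN; apply: eq_bigr => v _.
exact: gvar_anticomm.
Qed.

(** Membership in the subalgebra generated by the variables other than [v]. *)
Definition avoids v x := forall T, v \in T -> x T = 0.

Lemma avoidsM u v x : u != v -> avoids v x -> avoids v (gvar K u * x).
Proof.
move=> neq_uv avx T Tv; rewrite gvarM_coef; case: ifP => // _.
by rewrite avx ?mulr0 // !inE Tv eq_sym neq_uv.
Qed.

Lemma avoids_sumM v x :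
  avoids v x -> avoids v ((\sum_u gvar K u - gvar K v) * x).
Proof.
move=> avx; rewrite [_ - _]addrC (bigD1 v) //= addKr mulr_suml => T Tv.
rewrite sum_ffunE big1 // => u neq_uv; exact: (avoidsM neq_uv avx).
Qed.

Lemma avoids_decomp v x :
  exists y z, [/\ avoids v y, avoids v z & x = y + gvar K v * z].
Proof.
pose y : E := [ffun T : {set V} => if v \in T then 0 else x T].
(* The sign undoes the one that [gvarM_coef] produces on multiplying back by [gvar K v]. *)
pose z : E := [ffun T : {set V} => if v \in T then 0 else
  (-1) ^+ ninv [set v] T * x (v |: T)].
exists y, z; split=> [T vT|T vT|]; try by rewrite ffunE vT.
apply/ffunP=> T; rewrite ffunE gvarM_coef ffunE; case: ifP => vT.
  rewrite ffunE !inE eqxx /= setD1K // mulrA -exprMn mulrNN mulr1 expr1n mul1r.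
  by rewrite add0r.
by rewrite addr0.
Qed.

End GrassmannCoefficients.

(** * Homology of induced subgraphs and the deletion of a vertex *)

Section InducedSubgraphHomology.
Local Open Scope ring_scope.
Variables (K : fieldType) (V : finType) (G : sgraph V).
Local Notation E := (grassmann K V).
Local Notation s := (\sum_v gvar K v).
Implicit Types (x y : E) (u v w : V) (S T : {set V}).

Definition indep S T :=
  (T \subset S) && [forall u in T, forall v in T, ~~ G u v].

Definition nbhd w : {set V} := [set u | (u == w) || G w u].

Lemma indepP S T :
  reflect ({subset T <= S} /\ {in T &, forall u v, ~~ G u v}) (indep S T).
Proof.
apply: (iffP andP) => -[/subsetP TS indT]; split=> //.
  move=> u v Tu Tv.
  by move/forall_inP: indT => /(_ u Tu)/forall_inP/(_ v Tv).
by apply/forall_inP=> u Tu; apply/forall_inP=> v Tv; apply: indT.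
Qed.

Lemma indepS S T T' : T' \subset T -> indep S T -> indep S T'.
Proof.
move/subsetP=> T'T /indepP[TS indT]; apply/indepP; split=> [u /T'T/TS //|].
by move=> u v /T'T Tu /T'T Tv; apply: indT.
Qed.

Lemma indepT S S' T : S \subset S' -> indep S T -> indep S' T.
Proof. by move=> SS' /andP[TS ind]; rewrite /indep (subset_trans TS). Qed.

(** The link of [w] in the independence complex of [S] is the independence complex of [S] minus the
    closed neighbourhood of [w]. *)
Lemma indepU1 S T w : w \in S -> w \notin T ->
  indep S (w |: T) = indep (S :\: nbhd w) T.
Proof.
move=> Sw wNT; apply/indepP/indepP => -[TS indT].
  split=> [u Tu|u v Tu Tv]; last by apply: indT; rewrite !inE ?Tu ?Tv orbT.
  rewrite !inE negb_or TS ?inE ?Tu ?orbT // andbT.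
  rewrite (contraNneq _ wNT) => [|<- //].
  by apply: indT; rewrite !inE ?eqxx ?Tu ?orbT.
have TN u : u \in T -> [/\ u != w, ~~ G w u & u \in S].
  by move/TS; rewrite !inE negb_or => /andP[/andP[]].
split=> [u|u v].
  by rewrite !inE => /predU1P[-> //|/TN[]].
rewrite !inE => /predU1P[->|Tu] /predU1P[->|Tv]; rewrite ?adj_irr //.
- by case: (TN v Tv).
- by rewrite adj_sym; case: (TN u Tu).
exact: indT.
Qed.

Fact restr_is_linear S :
  linear (fun x => [ffun T => if indep S T then x T else 0] : E).
Proof.
move=> k x y; apply/ffunP=> T; rewrite !ffunE.
by case: ifP => _ //; rewrite addr0; apply/esym/mulr0.
Qed.

Definition restr S (x : E) : E := [ffun T => if indep S T then x T else 0].
HB.instance Definition _ S := GRing.isSemilinear.Build K E E _ (restr S)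
  (GRing.semilinear_linear (restr_is_linear S)).

(* The quotient E / edgeI S is the algebra of the induced subgraph G[S]: it
   kills the generators outside S. *)
Definition edgeI S : {vspace E} := lker (linfun (restr S)).
(** Preimages in [E] of the cycles and boundaries of [E / edgeI S]. Working with preimages keeps the
    complexes of all induced subgraphs inside one space. *)
Definition cyclesI S : {vspace E} := (amull (s : E) @^-1: edgeI S)%VS.
Definition boundsI S : {vspace E} := (limg (amull (s : E)) + edgeI S)%VS.

Lemma mem_edgeI S x : reflect (forall T, indep S T -> x T = 0) (x \in edgeI S).
Proof.
rewrite memv_ker lfunE /=; apply: (iffP eqP) => [/ffunP x0 T iT|x0].
  by have := x0 T; rewrite !ffunE iT.
by apply/ffunP=> T; rewrite !ffunE; case: ifP => // /x0.
Qed.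

Lemma edgeI_sub S S' : S \subset S' -> (edgeI S' <= edgeI S)%VS.
Proof.
by move=> SS'; apply/subvP=> x /mem_edgeI x0; apply/mem_edgeI => T /(indepT SS')/x0.
Qed.

Lemma edgeI_mul S x y : (x \in edgeI S) || (y \in edgeI S) -> x * y \in edgeI S.
Proof.
move=> Jxy; apply/mem_edgeI=> T iT; rewrite gmul_coef.
rewrite big1 // => A _; rewrite big1 // => C _.
have [defT|neqT] := eqVneq (A :|: C) T; last first.
  by rewrite gmon_mul_coef0 ?neqT ?mulr0.
have iA : indep S A by apply: indepS iT; rewrite -defT subsetUl.
have iC : indep S C by apply: indepS iT; rewrite -defT subsetUr.
by case/orP: Jxy => /mem_edgeI->; rewrite // ?mulr0 !mul0r.
Qed.

Lemma mem_cyclesI S x : (x \in cyclesI S) = (s * x \in edgeI S).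
Proof. by rewrite -memv_preim lfunE. Qed.

Lemma mem_boundsI S x : reflect (exists y, s * y - x \in edgeI S) (x \in boundsI S).
Proof.
apply: (iffP memv_addP) => [[_ /memv_imgP[y _ ->] [z Jz ->]]|[y Jy]].
  by exists y; rewrite lfunE /= opprD addrA subrr sub0r memvN.
exists (s * y); first by apply/memv_imgP; exists y; rewrite ?memvf ?lfunE.
exists (x - s * y); first by rewrite -memvN opprB.
by rewrite addrC subrK.
Qed.

Lemma boundsI_sub_cyclesI S : (boundsI S <= cyclesI S)%VS.
Proof.
apply/subvP=> x /mem_boundsI[y Jy]; rewrite mem_cyclesI.
have -> : s * x = - (s * (s * y - x)).
  by rewrite mulrBr mulrA gvar_sum_sqr mul0r sub0r opprK.
by rewrite memvN edgeI_mul ?Jy ?orbT.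
Qed.

Definition hdim S : nat := \dim (cyclesI S) - \dim (boundsI S).

(** Rank-nullity eliminates the cycles, so only the dimensions of [boundsI S] and [edgeI S] remain
    to be tracked. *)
Lemma hdimE S : (hdim S + 2 * \dim (boundsI S) = \dim {:E} + \dim (edgeI S))%N.
Proof.
rewrite mul2n -addnn addnA subnK ?dimvS ?boundsI_sub_cyclesI // addnC.
by rewrite dim_limgD ?subvf.
Qed.

(** The independence complex is a cone with apex [v]. If [x = y + v z] with [y] and [z] free of [v],
    then [z] is a primitive of the cycle [x]. *)
Lemma cyclesI_sub_boundsI_isolated S v :
  v \in S -> {in S, forall u, ~~ G v u} -> (cyclesI S <= boundsI S)%VS.
Proof.
move=> Sv isov; apply/subvP=> x; rewrite mem_cyclesI => /mem_edgeI Jsx.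
have [y [z [avy avz defx]]] := avoids_decomp v x.
apply/mem_boundsI; exists z.
suff Jt : (s - gvar K v) * z - y \in edgeI S.
  by rewrite defx opprD addrCA -mulrBl addrC.
apply/mem_edgeI=> T iT; rewrite !ffunE; have [vT|vNT] := boolP (v \in T).
  by rewrite (avoids_sumM avz) // avy // subrr.
have iTv : indep S (v |: T).
  rewrite indepU1 // (_ : _ :\: _ = S :\ v) //; last first.
    apply/setP=> u; rewrite !inE; case Su: (u \in S); rewrite ?andbF //.
    by rewrite (negPf (isov u Su)) orbF.
  apply/indepP; case/indepP: iT => TS indT; split=> // u Tu.
  by rewrite !inE TS // andbT; apply: contraNneq vNT => <-.
have := Jsx _ iTv.
(* The first summand avoids [v], so the coefficient of [s * x] at [v |: T] is, up to sign, that of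
   [(s - gvar K v) * z - y] at [T]. *)
have -> : s * x = (s - gvar K v) * y - gvar K v * ((s - gvar K v) * z - y).
  rewrite defx mulrDr mulrA -[s * gvar K v]opprK -gvar_sum_anticomm mulNr.
  rewrite [(s - _) * y]mulrBl mulrBr mulrA [_ * (s - _)]mulrBr gvar_sqr subr0.
  by rewrite opprB addrA subrK.
rewrite ffunE (avoids_sumM avy) ?setU11 // add0r ffunE gvarM_coef setU11 setU1K //.
by rewrite ffunE => /eqP; rewrite ffunE oppr_eq0 mulf_eq0 signr_eq0 => /eqP.
Qed.

Lemma hdim_isolated S v :
  v \in S -> {in S, forall u, ~~ G v u} -> hdim S = 0%N.
Proof.
by move=> Sv isov; apply/eqP; rewrite subn_eq0 dimvS // (cyclesI_sub_boundsI_isolated Sv).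
Qed.

Lemma indepD1 S T w : w \notin T -> indep (S :\ w) T = indep S T.
Proof.
move=> wNT; rewrite /indep; congr (_ && _); apply/subsetP/subsetP => TS u Tu.
  by have := TS u Tu; rewrite !inE => /andP[].
by rewrite !inE TS // andbT; apply: contraNneq wNT => <-.
Qed.

(** Multiplication by [gvar K w] embeds the algebra of [S :\: nbhd w] into that of [S]: the left
    half of a short exact sequence. *)
Lemma preim_gvar_edgeI S w : w \in S ->
  (amull (gvar K w) @^-1: edgeI S = edgeI (S :\: nbhd w))%VS.
Proof.
move=> Sw; apply/vspaceP=> x; rewrite -memv_preim lfunE /=.
apply/mem_edgeI/mem_edgeI => x0 T iT.
  have wNT : w \notin T.
    by apply/negP=> /(subsetP (proj1 (andP iT))); rewrite !inE eqxx.
  have := x0 (w |: T); rewrite indepU1 // gvarM_coef setU11 setU1K //.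
  by move=> /(_ iT)/eqP; rewrite mulf_eq0 signr_eq0 => /eqP.
rewrite gvarM_coef; case: ifP => // wT.
by rewrite x0 ?mulr0 // -indepU1 ?setD1K ?setD11.
Qed.

Lemma gvarM_edgeI S w x : gvar K w * x \in edgeI (S :\ w).
Proof.
apply/mem_edgeI=> T /indepP[TS _]; rewrite gvarM_coef; case: ifP => // /TS.
by rewrite !inE eqxx.
Qed.

(** The right half of the sequence: the cokernel of multiplication by [gvar K w] is the algebra of
    [S :\ w]. *)
Lemma limg_gvarD_edgeI S w : w \in S ->
  (limg (amull (gvar K w)) + edgeI S = edgeI (S :\ w))%VS.
Proof.
move=> Sw; apply/vspaceP=> x; apply/memv_addP/mem_edgeI.
  case=> _ /memv_imgP[y _ ->] [z Jz ->]; rewrite lfunE; apply/mem_edgeI.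
  by rewrite memvD ?gvarM_edgeI // (subvP (edgeI_sub _) _ Jz) ?subD1set.
move=> x0; have [y [z [avy _ defx]]] := avoids_decomp w x.
exists (gvar K w * z); first by apply/memv_imgP; exists z; rewrite ?memvf ?lfunE.
exists y; last by rewrite addrC.
apply/mem_edgeI=> T iT; have [/avy //|wNT] := boolP (w \in T).
have := x0 T; rewrite indepD1 // defx ffunE gvarM_coef (negPf wNT) addr0.
exact.
Qed.

Lemma dim_edgeI_vertex S w : w \in S ->
  (\dim (edgeI (S :\ w)) + \dim (edgeI (S :\: nbhd w)) = \dim {:E} + \dim (edgeI S))%N.
Proof.
move=> Sw; rewrite -limg_gvarD_edgeI // -preim_gvar_edgeI // dim_limgD //.
exact: subvf.
Qed.

(* As S :&: N[v] lies in N[w], restricting cochains from S - w to S - N[w]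
   factors through a subgraph in which v is isolated, so it vanishes in
   homology and the long exact sequence splits. *)
Lemma hdim_split S v w : v \in S -> w \in S -> G v w ->
  S :&: nbhd v \subset nbhd w ->
  hdim S = (hdim (S :\ w) + hdim (S :\: nbhd w))%N.
Proof.
move=> Sv Sw Gvw sNvw; set S0 := S :\ w; set S1 := S :\: nbhd w.
pose f : 'End(E) := amull (gvar K w).
have fE x : f x = gvar K w * x by rewrite lfunE.
have sJ : (edgeI S <= edgeI S0)%VS by rewrite edgeI_sub ?subD1set.
(* Injectivity of homology from [S1] to [S]: a boundary of [S] that vanishes on [S0] comes, modulo
   [edgeI S], from a boundary of [S1]. *)
have capE : (f @: boundsI S1 + edgeI S = boundsI S :&: edgeI S0)%VS.
  apply/vspaceP=> x; rewrite memv_cap; apply/memv_addP/andP.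
    case=> _ /memv_imgP[y /mem_boundsI[z Jz] ->] [t Jt ->]; rewrite fE; split.
      apply/mem_boundsI; exists (- (gvar K w * z)).
      rewrite mulrN mulrA -mulNr -gvar_sum_anticomm opprD addrA -mulrA -mulrBr.
      by rewrite memvB // -fE memv_preim preim_gvar_edgeI.
    by rewrite memvD ?gvarM_edgeI // (subvP sJ).
  case=> /mem_boundsI[y Jy] J0x.
  have [y0 [y1 [avy0 _ defy]]] := avoids_decomp w y.
  set g := gvar K w in defy; pose u := g * (y0 - s * y1).
  have syE : s * y = (s - g) * y0 + u.
    rewrite defy mulrDr mulrA -[s * g]opprK -gvar_sum_anticomm mulNr /u.
    by rewrite mulrBr mulrA mulrBl addrA subrK.
  have J0u : u \in edgeI S0 by apply: gvarM_edgeI.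
  have J0sy : s * y \in edgeI S0.
    by rewrite -[_ * y](subrK x) memvD // (subvP sJ).
  have J0t : (s - g) * y0 \in edgeI S0.
    by rewrite -[X in X \in _](addrK u) -syE memvB.
  (* On sets without [w], independence in [S0] and in [S] agree, and [(s - g) * y0] has no
     coefficient at the other sets. *)
  have Jt : (s - g) * y0 \in edgeI S.
    apply/mem_edgeI=> T iT; have [wT|wNT] := boolP (w \in T).
      exact: (avoids_sumM avy0).
    by move/mem_edgeI: J0t; apply; rewrite indepD1.
  have B1y0 : y0 \in boundsI S1.
    (* Here [v] is isolated and [S1 \subset S2 \subset S0]: the cycle [y0] of [S0] restricts to a
       cycle of [S2], hence to a boundary there and on [S1]. *)
    pose S2 := S :\: [set t | G v t].
    have sS20 : S2 \subset S0.
      apply/subsetP=> t; rewrite !inE => /andP[Gvt ->]; rewrite andbT.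
      by apply: contraNneq Gvt => ->.
    have sS12 : S1 \subset S2.
      apply/subsetP=> t; rewrite !inE => /andP[nNwt St]; rewrite St andbT.
      apply: contraNN nNwt => Gvt; have := subsetP sNvw t.
      by rewrite !inE St Gvt orbT; apply.
    have sB21 : (boundsI S2 <= boundsI S1)%VS by rewrite addvS ?edgeI_sub.
    apply: (subvP sB21); apply: (subvP (@cyclesI_sub_boundsI_isolated S2 v _ _)).
    - by rewrite !inE adj_irr Sv.
    - by move=> t; rewrite !inE => /andP[].
    rewrite mem_cyclesI (subvP (edgeI_sub sS20)) // -[s](subrK g) mulrDl.
    by rewrite memvD // gvarM_edgeI.
  exists u; last first.
    exists (x - u); last by rewrite addrC subrK.
    suff -> : x - u = (s - g) * y0 - (s * y - x) by apply: memvB.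
    by rewrite syE opprB addrCA opprD addNKr.
  rewrite /u -fE memv_img // memvB //; apply/mem_boundsI; exists y1.
  by rewrite subrr mem0v.
have fimg : (\dim (boundsI S :&: edgeI S0) + \dim (edgeI S1) =
    \dim (boundsI S1) + \dim (edgeI S))%N.
  have pJ : (f @^-1: edgeI S = edgeI S1)%VS by rewrite preim_gvar_edgeI.
  by rewrite -pJ -capE dim_limgD // pJ addvSr.
have BD : (boundsI S + edgeI S0 = boundsI S0)%VS.
  by rewrite /boundsI -addvA (addv_idPr (edgeI_sub _)) ?subD1set.
(* The sum and the intersection of [boundsI S] and [edgeI S0] are now known, so additivity is linear
   arithmetic in the dimensions. *)
have := dimv_sum_cap (boundsI S) (edgeI S0); rewrite BD.
have := dim_edgeI_vertex Sw; have := hdimE S; have := hdimE S0; have := hdimE S1.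
by rewrite -/S0 -/S1; lia.
Qed.

(** The algebra of the empty graph is [K] with zero differential. *)
Lemma hdim0 : hdim set0 = 1%N.
Proof.
have indep0 T : indep set0 T = (T == set0).
  apply/idP/eqP => [/andP[]|->]; first by rewrite subset0 => /eqP.
  by apply/indepP; split=> [u|u v]; rewrite inE.
have J0 x : (x \in edgeI set0) = (x set0 == 0).
  apply/mem_edgeI/eqP => [|x0 T]; first by apply; rewrite indep0.
  by rewrite indep0 => /eqP->.
have one0 : (1 : E) set0 = 1 by rewrite ffunE eqxx.
have BJ : boundsI set0 = edgeI set0.
  apply/addv_idPr/subvP=> _ /memv_imgP[y _ ->].
  rewrite lfunE J0 /= mulr_suml sum_ffunE big1 // => v _.
  by rewrite gvarM_coef inE.
have dimE : (1 + \dim (edgeI set0) = \dim {:E})%N.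
  have dim1 : \dim <[1 : E]>%VS = 1%N by rewrite dim_vline oner_eq0.
  rewrite -[X in (X + _)%N]dim1 -dimv_disjoint_sum; last first.
    apply/eqP; rewrite -subv0; apply/subvP=> x; rewrite memv_cap J0 memv0.
    case/andP=> /vlineP[k ->]; rewrite ffunE one0 => /eqP k0.
    by rewrite -[k]mulr1 [k * 1]k0 scale0r.
  congr (\dim _); apply/vspaceP=> x; rewrite memvf; apply/memv_addP.
  exists (x set0 *: (1 : E)); first by rewrite memvZ // memv_line.
  exists (x - x set0 *: (1 : E)); last by rewrite addrC subrK.
  by rewrite J0 !ffunE eqxx [_ *: _]mulr1 subrr.
have := hdimE set0; rewrite BJ; lia.
Qed.

End InducedSubgraphHomology.

(** * Identification of the graph algebra with the quotient by [edgeI] *)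

Section GraphAlgebraHomology.
Local Open Scope ring_scope.
Variables (K : fieldType) (V : finType) (G : sgraph V).
Local Notation E := (grassmann K V).
Local Notation X := (edge_monomials K G).
Local Notation s := (\sum_v gvar K v).

Lemma gmonU (S T : {set V}) : [disjoint S & T] ->
  gmon K (S :|: T) = (-1) ^+ ninv S T *: (gmon K S * gmon K T).
Proof.
move=> dST; rewrite [gmon K S * _]gmul_mon /gmon_mul dST.
by rewrite scalerA -exprMn mulrNN mulr1 expr1n scale1r.
Qed.

(** Both sides are spanned by the monomials of dependent sets: such a monomial is, up to sign, an
    edge monomial times the remaining variables. *)
Lemma ideal_edge_monomials : ideal_gen X = edgeI K G setT.
Proof.
apply/vspaceP=> x; apply/idP/idP => [|/mem_edgeI x0].
  apply/subvP/prodvP=> y z Xy _; apply: edgeI_mul; apply/orP; left.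
  apply: (subvP _ _ Xy); apply/prodvP=> t u _ Xu; apply: edgeI_mul; apply/orP; right.
  apply: (subvP _ _ Xu); apply/span_subvP=> e /mapP[[v w]].
  rewrite mem_enum inE /= => Gvw ->; apply/mem_edgeI=> T /indepP[_ indT].
  rewrite gvarM_coef; case: ifP => // vT; rewrite ffunE.
  case: eqP => [defT|]; last by rewrite mulr0.
  have wT : w \in T.
    have : w \in T :\ v by rewrite defT inE.
    by rewrite !inE => /andP[].
  by case/negP: (indT _ _ vT wT).
rewrite [x]gmon_expand memv_suml // => T _.
have [/x0->|] := boolP (indep G setT T); first by rewrite scale0r mem0v.
move=> nindT; apply: memvZ; move: nindT; rewrite /indep subsetT /=.
case/forall_inPn=> u Tu /forall_inPn[v Tv]; rewrite negbK => Guv.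
have neq_uv : u != v by apply: contraTneq Guv => ->; rewrite adj_irr.
have -> : T = ([set u] :|: [set v]) :|: (T :\ u :\ v).
  by rewrite -setUA setD1K ?setD1K // !inE Tv eq_sym neq_uv.
rewrite gmonU; last first.
  by rewrite -setI_eq0; apply/eqP/setP=> w; rewrite !inE; do 2!case: eqP.
apply: memvZ; apply: ideal_genMr.
rewrite gmonU ?disjoints1 ?inE //; apply: memvZ; apply: mem_ideal_gen.
by apply/mapP; exists (u, v); rewrite ?mem_enum.
Qed.

(** The projection [pi] maps [cyclesI] onto the kernel and [boundsI] onto the image of the
    differential. Both contain its kernel, whose dimension cancels in the difference. *)
Lemma homology_dim_graph : homology_dim (graph_diff K G) = hdim K G setT.
Proof.
pose A := graph_alg K G; pose pi : 'Hom(E, A) := linfun (pi_alg X).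
have piE x : pi x = pi_alg X x by rewrite lfunE.
have ker_pi : lker pi = edgeI K G setT.
  rewrite -ideal_edge_monomials; apply/vspaceP=> x; rewrite memv_ker piE.
  by have := pi_algE X x 0; rewrite subr0 linear0.
have Dpi x : graph_diff K G (pi x) = pi (s * x).
  rewrite graph_diffE !piE rmorphM; congr (_ * _).
  by rewrite raddf_sum.
have pi_surj (y : A) : exists x, y = pi x.
  by have [x ->] := pi_algP y; exists x; rewrite piE.
have sJB : (edgeI K G setT <= boundsI K G setT)%VS by apply: addvSr.
have imgE : (pi @: boundsI K G setT = limg (graph_diff K G))%VS.
  apply/vspaceP=> y; apply/memv_imgP/memv_imgP => [[x /mem_boundsI[z Jz] ->]|[z _ ->]].
    exists (pi z); rewrite ?memvf // Dpi; apply/eqP; rewrite eq_sym -subr_eq0.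
    by rewrite -linearB /= -memv_ker ker_pi.
  have [x ->] := pi_surj z; exists (s * x); last by rewrite Dpi.
  by apply/mem_boundsI; exists x; rewrite subrr mem0v.
have kerE : (pi @: cyclesI K G setT = lker (graph_diff K G))%VS.
  apply/vspaceP=> y; rewrite memv_ker; apply/memv_imgP/eqP => [[x Zx ->]|].
    by apply/eqP; rewrite Dpi -memv_ker ker_pi -mem_cyclesI.
  have [x ->] := pi_surj y; rewrite Dpi => /eqP sx0; exists x => //.
  by rewrite mem_cyclesI -ker_pi memv_ker.
have dim_pi (U : {vspace E}) : (edgeI K G setT <= U)%VS ->
    (\dim (pi @: U) + \dim (edgeI K G setT) = \dim U)%N.
  by move=> sJU; rewrite -(limg_ker_dim pi U) ker_pi (capv_idPr sJU) addnC.
rewrite /hdim -(dim_pi (cyclesI K G setT)) ?(subv_trans sJB) ?boundsI_sub_cyclesI //.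
rewrite -(dim_pi (boundsI K G setT)) // subnDr.
by rewrite imgE kerE -(homology_dimE (graph_diff_img_ker K G)) addnK.
Qed.

End GraphAlgebraHomology.

(** * Words, descendants and neighbourhoods in the tree *)

Section TreeCombinatorics.
Variable n : nat.
Local Notation V := (tree_vertex n).
Local Notation N := (nbhd (Gamma n)).
Implicit Types (u v t c : V) (x y : seq bool) (S : {set V}).

Lemma size_word u : size (word u) = (tag u).+1.
Proof. exact: size_tuple. Qed.

Lemma word_inj : injective (@word n).
Proof.
move=> [i s] [j t]; rewrite /word /= => eq_st.
have eq_ij : i = j.
  by apply/val_inj/eqP; rewrite -eqSS -(size_tuple s) -(size_tuple t) eq_st.
by move: t eq_st; rewrite -eq_ij => t /val_inj->.
Qed.

Lemma word_parent u : exists b, word u = rcons (parent u) b.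
Proof.
have := size_word u; rewrite /parent; case/lastP: (word u) => // y b.
rewrite size_rcons => -[<-]; exists b.
by rewrite -{2}cats1 take_size_cat.
Qed.

Lemma parent_rcons u x b : word u = rcons x b -> parent u = x.
Proof. by have [b' ->] := word_parent u => /rcons_inj[]. Qed.

Lemma wordP x b : size x <= n -> {u : V | word u = rcons x b}.
Proof.
move=> lt_xn; have sz : size (rcons x b) == (size x).+1 by rewrite size_rcons.
by exists (Tagged (fun j : 'I_n.+1 => j.+1.-tuple bool)
  (Tuple sz : (Ordinal (lt_xn : size x < n.+1)).+1.-tuple bool)).
Qed.

Lemma in_nbhd u v : (v \in N u) =
  [|| word u == parent v, word v == parent u | parent u == parent v].
Proof.
rewrite inE /= /Gamma_adj /is_parent /siblings.
by case: eqVneq => [->|]; rewrite ?eqxx ?orbT.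
Qed.

(** A set with at most one element rather than a vertex, so that [x = [::]], the deleted root, is
    allowed and gives the empty set. *)
Definition at_word x : {set V} := [set u | word u == x].
(** Testing the parent, not the word, leaves out the vertex at [x] itself. *)
Definition desc x : {set V} := [set u | prefix x (parent u)].

Lemma prefix_bool x y :
  prefix x y = [|| y == x, prefix (rcons x false) y | prefix (rcons x true) y].
Proof.
elim: x y => [|a x IH] [|b y] //; first by rewrite /= prefix0s; case: b.
rewrite !rcons_cons !prefix_cons IH eqseq_cons eq_sym.
by case: eqP.
Qed.

Lemma prefix_rcons_inj x a b y :
  prefix (rcons x a) y -> prefix (rcons x b) y -> a = b.
Proof.
move=> /prefixP[s ->] /prefixP[t]; rewrite !cat_rcons.
by move/eqP; rewrite eqseq_cat // eqxx => /andP[_ /eqP[]].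
Qed.

Lemma prefix_rcons_neq x a y : prefix (rcons x a) y -> y != x.
Proof.
move=> /size_prefix; rewrite size_rcons; apply: contraTneq => ->.
by rewrite ltnn.
Qed.

Lemma at_word1 c : at_word (word c) = [set c].
Proof. by apply/setP=> u; rewrite !inE (inj_eq word_inj). Qed.

Lemma desc_word x u : u \in desc x -> prefix x (word u).
Proof.
have [b ->] := word_parent u; rewrite inE => /prefix_trans; apply.
exact: prefix_rcons.
Qed.

Lemma desc_rcons x b u : u \in desc (rcons x b) -> u \in desc x.
Proof. by rewrite !inE; apply/prefix_trans/prefix_rcons. Qed.

Lemma nbhd_child_out x b c u : word c = rcons x b -> u \notin desc x ->
  (u \in N c) = (u \in at_word x).
Proof.
move=> wc; rewrite in_nbhd wc (parent_rcons wc) !inE => uND.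
have /negPf-> : rcons x b != parent u.
  by apply: contraNneq uND => <-; apply: prefix_rcons.
have /negPf-> : x != parent u by apply: contraNneq uND => <-; apply: prefix_refl.
by rewrite orbF.
Qed.

Lemma nbhd_child_desc x a b c u : word c = rcons x a ->
  u \in desc (rcons x b) -> (u \in N c) -> a = b.
Proof.
move=> wc uD; rewrite in_nbhd wc (parent_rcons wc).
have := desc_word uD => /prefix_rcons_neq/negPf->.
move: uD; rewrite inE => uD; rewrite [x == _]eq_sym (negPf (prefix_rcons_neq uD)).
by rewrite !orbF => /eqP eq_a; apply: prefix_rcons_inj uD; rewrite -eq_a prefix_refl.
Qed.

Lemma at_word_desc x u : u \in desc x -> u \notin at_word x.
Proof.
rewrite !inE; have [b ->] := word_parent u; move=> /size_prefix sz.
by apply: contraTneq sz => <-; rewrite size_rcons ltnn.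
Qed.

Lemma child_desc x b c : word c = rcons x b -> c \in desc x.
Proof. by move=> wc; rewrite inE (parent_rcons wc) prefix_refl. Qed.

Lemma child_desc_rcons x a b c : word c = rcons x a -> c \notin desc (rcons x b).
Proof.
move=> wc; rewrite inE (parent_rcons wc).
by apply/negP=> /prefix_rcons_neq; rewrite eqxx.
Qed.

Lemma children_nbhd x a b c d :
  word c = rcons x a -> word d = rcons x b -> d \in N c.
Proof.
by move=> wc wd; rewrite in_nbhd (parent_rcons wc) (parent_rcons wd) eqxx !orbT.
Qed.

(** The membership patterns of a vertex [u] with respect to the children [l] and [r] of [x], in the
    order of [childP]. The free boolean says whether [u] is at [x] in [ChildOut], and whether it is
    a child of [l] or of [r] in the last two cases. *)
Variant child_spec :
  bool -> bool -> bool -> bool -> bool -> bool -> bool -> bool -> Prop :=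
| ChildOut b : child_spec false false false false false b b b
| ChildLeft : child_spec true false false false true false true true
| ChildRight : child_spec false true false false true false true true
| DescLeft b : child_spec false false true false true false b false
| DescRight b : child_spec false false false true true false false b.

Lemma childP x l r u : word l = rcons x false -> word r = rcons x true ->
  child_spec (u == l) (u == r) (u \in desc (rcons x false))
    (u \in desc (rcons x true)) (u \in desc x) (u \in at_word x)
    (u \in N l) (u \in N r).
Proof.
move=> wl wr; have neq_lr : l != r.
  by rewrite -(inj_eq word_inj) wl wr eqseq_rcons andbF.
have [uD|uND] := boolP (u \in desc x); last first.
  rewrite (nbhd_child_out wl uND) (nbhd_child_out wr uND).
  have /negPf-> : u != l by apply: contraNneq uND => ->; apply: child_desc wl.
  have /negPf-> : u != r by apply: contraNneq uND => ->; apply: child_desc wr.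
  have /negPf-> : u \notin desc (rcons x false).
    by apply: contraNN uND; apply: desc_rcons.
  have /negPf-> : u \notin desc (rcons x true).
    by apply: contraNN uND; apply: desc_rcons.
  exact: ChildOut.
rewrite (negPf (at_word_desc uD)).
have [->|neq_ul] := eqVneq u l.
  rewrite (negPf neq_lr) !(negPf (child_desc_rcons _ wl)).
  rewrite (children_nbhd wl wl) (children_nbhd wr wl); exact: ChildLeft.
have [->|neq_ur] := eqVneq u r.
  rewrite !(negPf (child_desc_rcons _ wr)).
  rewrite (children_nbhd wl wr) (children_nbhd wr wr); exact: ChildRight.
move: uD; rewrite inE prefix_bool => /or3P[/eqP pu|uD|uD].
- have [b wu] := word_parent u; rewrite pu in wu.
  by case: b wu neq_ul neq_ur; rewrite -?wl -?wr => /word_inj->; rewrite eqxx.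
- have uDl : u \in desc (rcons x false) by rewrite inE.
  rewrite uDl; have /negPf-> : u \notin desc (rcons x true).
    by apply/negP; rewrite inE => /(prefix_rcons_inj uD).
  have /negPf-> : u \notin N r by apply/negP=> /(nbhd_child_desc wr uDl).
  exact: DescLeft.
have uDr : u \in desc (rcons x true) by rewrite inE.
rewrite uDr; have /negPf-> : u \notin desc (rcons x false).
  by apply/negP; rewrite inE => /(prefix_rcons_inj uD).
have /negPf-> : u \notin N l by apply/negP=> /(nbhd_child_desc wl uDr).
exact: DescRight.
Qed.

End TreeCombinatorics.

(* The triple (rho, kap, sig) of a subtree with m levels below its root. *)
Fixpoint branch (m : nat) : nat * nat * nat :=
  if m is m'.+1 then
    let: (rho, kap, sig) := branch m' in
    (kap ^ 2, rho ^ 2 + 2 * (rho * sig) + 2 * (kap * sig),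
     rho ^ 2 + 2 * (rho * kap))
  else (1, 0, 0).

Local Definition in_sets :=
  (in_setU, in_setI, in_setD, in_set1, in_set0).

(** Proves equalities of vertex sets by running through [child_spec] and membership in [S]; a vertex
    of [S] leaves only the case [ChildOut]. *)
Ltac set_cases eq_sets :=
  apply: eq_sets => ?; rewrite ?in_sets => -[[]|||[]|[]] //=;
  match goal with |- context [?u \in ?S] => by case: (u \in S) => [/(_ isT)|] end.

(** * Gluing a subtree to a graph *)

Section Gluing.
Variables (K : fieldType) (n : nat).
Local Notation V := (tree_vertex n).
Local Notation h := (hdim K (Gamma n)).
Local Notation N := (nbhd (Gamma n)).
Implicit Types (u v t c : V) (x y : seq bool) (S : {set V}).

(** The only possible neighbour of [c] in [S] is the vertex at [x]. If it is missing, [c] is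
    isolated and the sum is empty; otherwise [hdim_split] deletes it, and the term where [c] becomes
    isolated vanishes. *)
Lemma hdim_pendant x b c S : word c = rcons x b -> [disjoint S & desc n x] ->
  h (c |: S) = \sum_(u in S :&: at_word n x) h (S :\: N u).
Proof.
move=> wc dS; have cNS : c \notin S by rewrite (disjointFl dS (child_desc wc)).
have adjc u : u \in S -> Gamma n c u = (u \in at_word n x).
  move=> Su; rewrite -(nbhd_child_out wc) ?(disjointFr dS Su) //.
  by rewrite [RHS]inE; case: eqP => // eq_uc; rewrite -eq_uc Su in cNS.
have iso S' : S' \subset S -> (forall u, u \in S' -> u \notin at_word n x) ->
    h (c |: S') = 0.
  move=> /subsetP sS' outS'; apply: (@hdim_isolated _ _ _ _ c (setU11 _ _)) => u.
  case/setU1P=> [->|S'u]; first by rewrite adj_irr.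
  by rewrite adjc ?sS' ?outS'.
have [E|[u]] := set_0Vmem (S :&: at_word n x).
  rewrite E big_set0 iso // => u Su; apply/negP=> Pu.
  by have := in_set0 u; rewrite -E in_setI Su Pu.
case/setIP=> Su Pu.
have Pdef : at_word n x = [set u].
  by rewrite -at_word1; congr at_word; move: Pu; rewrite inE => /eqP.
have -> : S :&: at_word n x = [set u] by rewrite Pdef; apply/setIidPr; rewrite sub1set.
rewrite big_set1 (@hdim_split _ _ _ _ c u) ?setU11 ?setU1r ?adjc //; last first.
  apply/subsetP=> t /setIP[/setU1P[->|St] Nt]; rewrite inE.
    by rewrite adj_sym adjc ?Pu ?orbT.
  rewrite inE in Nt; case/orP: Nt => [/eqP->|]; first by rewrite adj_sym adjc ?Pu ?orbT.
  by rewrite adjc // Pdef inE => ->.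
have neq_cu : c != u by apply: contraNneq cNS => ->.
have -> : (c |: S) :\ u = c |: (S :\ u).
  by apply/setP=> t; rewrite !inE; case: (eqVneq t c) => // ->; rewrite neq_cu.
rewrite iso ?subD1set // => [|t]; last by rewrite Pdef !inE => /andP[].
rewrite add0n; congr (h _); apply/setP=> t; rewrite !in_setD in_setU1.
case: (eqVneq t c) => [->|//]; rewrite (negPf cNS) andbF.
by rewrite [c \in _]inE adj_sym adjc ?Pu ?orbT.
Qed.

(* For x = [::] no vertex has word x and the sum is empty: this is how the two
   trees hanging below the deleted root are joined. *)
Lemma hdim_glue m x S : size x + m = n.+1 -> [disjoint S & desc n x] ->
  let: (rho, kap, sig) := branch m in
  h (S :|: desc n x) = rho * h S + kap * h (S :\: at_word n x) +
    sig * \sum_(u in S :&: at_word n x) h (S :\: N u).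
Proof.
elim: m x S => [|m IH] x S sz dS /=.
  (* Here [x] has length [n.+1], the bottom level, so nothing lies below it. *)
  have -> : desc n x = set0.
    apply/setP=> u; rewrite !inE; apply/negP=> /size_prefix.
    rewrite -(addn0 (size x)) sz -ltnS; have [b wu] := word_parent u.
    by rewrite -(size_rcons _ b) -wu size_word ltnS leqNgt ltn_ord.
  by rewrite setU0 mul1n !mul0n !addn0.
case: (branch m) IH => [[rho kap] sig] IH.
have le_xn : size x <= n by move: sz; rewrite addnS => -[<-]; apply: leq_addr.
have [l wl] := wordP false le_xn; have [r wr] := wordP true le_xn.
pose Dl := desc n (rcons x false); pose Dr := desc n (rcons x true).
have out u : u \in S -> u \in desc n x = false by apply: disjointFr.
(* The induction hypothesis at a child [c]: when [c] is absent from [S'], deleting it changes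
   nothing and the last term is empty, which leaves the factor [rho + kap]. *)
have IHc b c S' : word c = rcons x b -> [disjoint S' & desc n (rcons x b)] ->
    h (S' :|: desc n (rcons x b)) =
      if c \in S' then rho * h S' + kap * h (S' :\ c) + sig * h (S' :\: N c)
      else (rho + kap) * h S'.
  move=> wc dS'; rewrite (IH (rcons x b)) ?size_rcons ?addSnnS //.
  rewrite -wc at_word1; case: ifP => [S'c|/negbT S'Nc].
    by rewrite (setIidPr _) ?sub1set // big_set1.
  rewrite (_ : S' :&: [set c] = set0); last first.
    by apply/eqP; rewrite setI_eq0 disjoint_sym disjoints1.
  rewrite (_ : S' :\: [set c] = S').
    by rewrite big_set0 muln0 addn0 mulnDl.
  by apply/setDidPl; rewrite disjoint_sym disjoints1.
set P := at_word n x; set q := \sum_(u in S :&: P) h (S :\: N u).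
have eq_sets (A A' : {set V}) : (forall u, child_spec (u == l) (u == r)
    (u \in Dl) (u \in Dr) (u \in desc n x) (u \in P) (u \in N l) (u \in N r) ->
    (u \in S -> u \in desc n x = false) -> (u \in A) = (u \in A')) -> A = A'.
  by move=> eqAA'; apply/setP=> u; apply: eqAA' (childP u wl wr) (out u).
have disj (A A' : {set V}) : A :&: A' = set0 -> [disjoint A & A'].
  by move/eqP; rewrite setI_eq0.
(* The tree below [l] is glued first, onto a set containing [l], [r] and the tree below [r]; the
   latter is then glued in each of the three resulting terms. *)
have -> : S :|: desc n x = (l |: (r |: (S :|: Dr))) :|: Dl by set_cases eq_sets.
rewrite (IHc _ _ _ wl) ?setU11; last by apply: disj; set_cases eq_sets.
have -> : (l |: (r |: (S :|: Dr))) :\ l = (r |: S) :|: Dr by set_cases eq_sets.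
have -> : (l |: (r |: (S :|: Dr))) :\: N l = (S :\: P) :|: Dr by set_cases eq_sets.
have -> : (l |: (r |: (S :|: Dr))) = (l |: (r |: S)) :|: Dr by set_cases eq_sets.
rewrite !(IHc _ _ _ wr); try by apply: disj; set_cases eq_sets.
(* Deleting the closed neighbourhood of [l] removes the sibling [r] and the vertex at [x] too, so
   this term takes the second branch of [IHc]. *)
have rNS0 : r \notin (S :\: P).
  by rewrite in_setD (disjointFl dS (child_desc wr)) andbF.
rewrite (negPf rNS0) !(in_setU, in_set1) eqxx orbT /=.
have -> : (r |: S) :\ r = S by set_cases eq_sets.
have -> : (r |: S) :\: N r = (S :\: P) by set_cases eq_sets.
have Mr : (l |: (r |: S)) :\ r = l |: S by set_cases eq_sets.
have MNr : (l |: (r |: S)) :\: N r = (S :\: P) by set_cases eq_sets.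
rewrite Mr MNr.
have neq_lr : r != l by rewrite -(inj_eq (@word_inj n)) wl wr eqseq_rcons andbF.
(* Without their subtrees, [l] and [r] are adjacent with the same closed neighbourhood, so
   [hdim_split] applies. *)
have -> : h (l |: (r |: S)) = h (l |: S) + h (S :\: P).
  rewrite -{1}Mr -MNr; apply: (@hdim_split _ _ _ _ l).
  - exact: setU11.
  - by rewrite !in_sets eqxx orbT.
  - have := children_nbhd wl wr; rewrite inE (negPf neq_lr); exact.
  apply/subsetP=> u; rewrite !in_sets; move: (out u).
  by case: (childP u wl wr) => [[]|||[]|[]]; case: (u \in S) => [/(_ isT)|].
rewrite !(hdim_pendant wl dS) !(hdim_pendant wr dS) -/q.
ring.
Qed.

End Gluing.

(** * The sequences as products of branch invariants, and the total homology *)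

Theorem mainTheorem6 (K : fieldType) (a b c p q r : nat -> nat)
  (a1 : a 1 = 0) (p1 : p 1 = 0) (q1 : q 1 = 0)
  (b1 : b 1 = 1) (c1 : c 1 = 1) (r1 : r 1 = 1)
  (aS : forall n, 1 <= n -> a n.+1 = c n ^ 2)
  (bS : forall n, 1 <= n -> b n.+1 = (a n + 2 * q n) ^ 2)
  (cS : forall n, 1 <= n -> c n.+1 = (a n + 2 * p n + 2 * r n) ^ 2)
  (pS : forall n, 1 <= n -> p n.+1 = c n * (a n + 2 * q n))
  (qS : forall n, 1 <= n -> q n.+1 = c n * (a n + 2 * p n + 2 * r n))
  (rS : forall n, 1 <= n ->
     r n.+1 = (a n + 2 * q n) * (a n + 2 * p n + 2 * r n))
  (n : nat) (n_ge1 : 1 <= n) :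
  homology_dim (graph_diff K (Gamma n)) = a n + c n + 2 * p n + 2 * r n.
Proof.
(* The sequences at [m] are quadratic monomials in the triple [branch m], which starts at
   [(0, 1, 1)] for [m = 1]. *)
have branchE m : 0 < m -> let: (rho, kap, sig) := branch m in
    [/\ a m = rho ^ 2, c m = kap ^ 2, p m = rho * sig, q m = rho * kap
      & r m = kap * sig].
  elim: m => // -[_ _|m IH _]; first by rewrite /= a1 c1 p1 q1 r1.
  have {IH} := IH isT; rewrite [branch m.+2]/=; rewrite -/(branch m.+1).
  case: (branch m.+1) => [[rho kap] sig] [aE cE pE qE rE].
  rewrite (aS m.+1) // (cS m.+1) // (pS m.+1) // (qS m.+1) // (rS m.+1) //.
  by rewrite aE cE pE qE rE; split; ring.
rewrite homology_dim_graph.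
have -> : [set: tree_vertex n] = set0 :|: desc n [::].
  by apply/setP=> u; rewrite !inE prefix0s.
(* The whole graph is what hangs below the deleted root, a tree with [n.+1] levels under it, glued
   to the empty graph. *)
have := @hdim_glue K n n.+1 [::] set0 (erefl _).
rewrite -setI_eq0 set0I eqxx => /(_ isT) /=.
case: (branch n) (branchE n n_ge1) => [[rho kap] sig] [-> -> -> _ ->] ->.
(* The first two terms carry the homology dimension 1 of the empty graph and the third is an empty
   sum, so the result is the [rho] plus the [kap] entry of [branch n.+1]. *)
rewrite set0D set0I big_set0 hdim0; ring.
Qed.
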